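(* Let $\big(\{(X_i,d_i,\mathfrak m_i,p_i)\}_{i\in\mathbb N},\{\varphi_{ij}\}_{i\le j}\big)$ be a direct system of pointed Polish metric measure spaces. It admits a direct limit $(X,d_X,\mathfrak m_X,p_X)$ (in the category of pointed Polish metric measure spaces) if and only if the sequence $\big((X_i,d_i,\mathfrak m_i,p_i)\big)$ is uniformly boundedly finite, i.e. $\sup_{i\in\mathbb N}\mathfrak m_i(B(p_i,R))<+\infty$ for every $R>0$. In this case, $(X,d_X,\mathfrak m_X,p_X)$ coincides with the weak pointed measured Gromov--Hausdorff limit of $\big((X_i,d_i,\mathfrak m_i,p_i)\big)$.
   Context: In this statement, a pointed Polish metric measure space $(X,d,\mathfrak m,p)$ is a complete separable metric space with a Borel measure $\mathfrak m$ finite on balls and a point $p\in{\rm spt}(\mathfrak m)$, where ${\rm spt}(\mathfrak m):=\{x:\mathfrak m(B(x,r))>0\ \forall r>0\}$ and $B(x,r)$ is the open ball. A morphism $\varphi\colon(X,d_X,\mathfrak m_X,p_X)\to(Y,d_Y,\mathfrak m_Y,p_Y)$ is a Borel map $\varphi\colon X\to Y$ with $\varphi(p_X)=p_Y$, with $\varphi|_{{\rm spt}(\mathfrak m_X)}$ $1$-Lipschitz, and with $\varphi_*\mathfrak m_X\le\mathfrak m_Y$. The isomorphisms are the morphisms $\varphi$ such that $\varphi|_{{\rm spt}(\mathfrak m_X)}$ is an isometry and $\varphi_*\mathfrak m_X=\mathfrak m_Y$. Direct system: morphisms $\varphi_{ij}\colon X_i\to X_j$ ($i\le j$) with $\varphi_{ii}={\rm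 id}_{X_i}$ and $\varphi_{ik}=\varphi_{jk}\circ\varphi_{ij}$ for $i\le j\le k$. A target is a pointed Polish metric measure space $Y$ with morphisms $\psi_i\colon X_i\to Y$ such that $\psi_i=\psi_j\circ\varphi_{ij}$ for $i\le j$. A direct limit is a target $(X,\{\varphi_i\})$ such that for every target $(Y,\{\psi_i\})$ there is a unique morphism $\Phi\colon X\to Y$ with $\psi_i=\Phi\circ\varphi_i$ for all $i$. Whenever it exists, the direct limit is determined up to unique isomorphism; ''coincides'' is understood up to isomorphism. Weak $(R,\varepsilon)$-approximation ($0<\varepsilon<R$) from $(X,d_X,\mathfrak m_X,p_X)$ to $(Y,d_Y,\mathfrak m_Y,p_Y)$: a Borel map $\psi\colon B(p_X,R)\to Y$ with $\psi(p_X)=p_Y$ for which there is a Borel set $\tilde X\subset B(p_X,R)$ containing $p_X$ with (1) $|d_X(x,y)-d_Y(\psi(x),\psi(y))|\le\varepsilon$ for all $x,y\in\tilde X$; (2) $\mathfrak m_X(B(p_X,R)\setminus\tilde X)\le\varepsilon$ and $\mathfrak m_Y\big(B(p_Y,R-\varepsilon)\setminus\psi(\tilde X)^\varepsilon\big)\le\varepsilon$, where $A^\varepsilon:=\{y:{\rm dist}(y,A)<\varepsilon\}$. Such a map can always be extended in a Borel manner to the whole space $X$, and weak approximations are regarded as (so extended) Borel maps $\psi\colon X\to Y$. Weak pointed measured Gromov--Hausdorff (wpmGH) convergence of $(X_i,d_i,\mathfrak m_i,p_i)$ to $(X_\infty,d_\infty,\mathfrak m_\infty,p_\infty)$: there are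 $R_i\nearrow+\infty$, $\varepsilon_i\searrow0$ and weak $(R_i,\varepsilon_i)$-approximations $\psi_i\colon X_i\to X_\infty$ with $(\psi_i)_*\mathfrak m_i\rightharpoonup\mathfrak m_\infty$, i.e. $\int\varphi\circ\psi_i\,d\mathfrak m_i\to\int\varphi\,d\mathfrak m_\infty$ for all bounded continuous $\varphi\colon X_\infty\to\mathbb R$ with bounded support.
   Formalization: Morphisms are identified when they agree on the support; wpmGH convergence asks for weak approximations only for all large i; the direct limit is shown to be a wpmGH limit, without uniqueness of such limits. Read literally, each of these points fails. *)

(* Defs.v *)
From HB Require Import structures.
From mathcomp Require Import all_boot all_order all_algebra.
From mathcomp Require Import all_classical all_reals all_analysis.

Set Implicit Arguments.
Unset Strict Implicit.
Unset Printing Implicit Defensive.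

Import Order.TTheory GRing.Theory Num.Theory.
Import numFieldNormedType.Exports.

Local Open Scope classical_set_scope.
Local Open Scope ring_scope.

#[short(type="completeMetricType")]
HB.structure Definition CompleteMetric (R : numDomainType) :=
  {T of Complete T & Metric R T}.

Notation borel T := (g_sigma_algebraType (@open T)).

(* The library's complete and measurable types are pointed; the distinguished
   point [point] of the carrier is taken to be the base point of the space. *)
Record ppmms (R : realType) := Ppmms {
  pp_space :> completeMetricType R ;
  pp_meas : {measure set (borel pp_space) -> \bar R} ;
  pp_separable : exists2 D : set pp_space, countable D & dense D ;
  pp_ball_fin : forall (x : pp_space) (r : R), (pp_meas (ball x r) < +oo)%E ;
  pp_base_spt : forall r : R, 0 < r ->
    (0 < pp_meas (ball (point : pp_space) r))%E }.

Section Definitions.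
Variable R : realType.
Implicit Types X Y L : ppmms R.

Definition base X : X := point.

Definition spt X : set X :=
  [set x | forall r : R, 0 < r -> (0 < pp_meas X (ball x r))%E].
Arguments spt : clear implicits.

Definition borel_map X Y (f : X -> Y) : Prop :=
  measurable_fun [set: borel X] (f : borel X -> borel Y).

Definition is_morphism X Y (f : X -> Y) : Prop :=
  [/\ borel_map f,
      f (base X) = base Y,
      (forall x y, spt X x -> spt X y -> mdist (f x) (f y) <= mdist x y) &
      (forall B : set (borel Y), measurable B ->
        (pushforward (pp_meas X) (f : borel X -> borel Y) B
           <= pp_meas Y B)%E)].

(* Equality of morphisms: they are identified when they agree on the support
   (equivalently, almost everywhere).  This is what makes every
   measure-preserving map that is isometric on the support invertible, hence an
   isomorphism.  With pointwise equality off the supports, where a morphism is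
   an arbitrary Borel map, direct limits of uniformly boundedly finite systems
   need not exist: take X_i = {0,1}^N + {p} with Dirac mass at p and the shift as
   transition map.  A Borel map on X_0 invariant under eventual equality is
   constant on a comeagre set of sequences, so no single one of them can factor
   all the others. *)
Definition mor_eq X Y (f g : X -> Y) : Prop := {in spt X, f =1 g}.

Definition is_direct_system (X : nat -> ppmms R)
    (phi : forall i j : nat, (i <= j)%N -> X i -> X j) : Prop :=
  [/\ (forall i j (ij : (i <= j)%N), is_morphism (phi i j ij)),
      (forall i, mor_eq (phi i i (leqnn i)) id) &
      (forall i j k (ij : (i <= j)%N) (jk : (j <= k)%N),
        mor_eq (phi i k (leq_trans ij jk)) (phi j k jk \o phi i j ij))].

Definition is_target (X : nat -> ppmms R)
    (phi : forall i j : nat, (i <= j)%N -> X i -> X j)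
    Y (psi : forall i, X i -> Y) : Prop :=
  (forall i, is_morphism (psi i)) /\
  (forall i j (ij : (i <= j)%N), mor_eq (psi i) (psi j \o phi i j ij)).

Definition is_direct_limit (X : nat -> ppmms R)
    (phi : forall i j : nat, (i <= j)%N -> X i -> X j)
    L (f : forall i, X i -> L) : Prop :=
  is_target phi f /\
  forall Y (psi : forall i, X i -> Y), is_target phi psi ->
    exists Phi : L -> Y,
      [/\ is_morphism Phi,
          (forall i, mor_eq (psi i) (Phi \o f i)) &
          (forall Phi' : L -> Y, is_morphism Phi' ->
            (forall i, mor_eq (psi i) (Phi' \o f i)) -> mor_eq Phi' Phi)].

Definition unif_boundedly_finite (X : nat -> ppmms R) : Prop :=
  forall r : R, 0 < r ->
    (ereal_sup [set pp_meas (X i) (ball (base (X i)) r) | i in [set: nat]]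
       < +oo)%E.

Definition enlarge Y (A : set Y) (e : R) : set Y :=
  [set y | (edist_inf A y < e%:E)%E].

Definition weak_approx X Y (r e : R) (psi : X -> Y) : Prop :=
  [/\ 0 < e < r,
      borel_map psi,
      psi (base X) = base Y &
      exists A : set X,
        [/\ measurable (A : set (borel X)) /\ A `<=` ball (base X) r,
            A (base X),
            (forall x y, A x -> A y ->
              `|mdist x y - mdist (psi x) (psi y)| <= e),
            (pp_meas X (ball (base X) r `\` A) <= e%:E)%E &
            (pp_meas Y (ball (base Y) (r - e) `\` enlarge (psi @` A) e)
               <= e%:E)%E]].

Definition bounded_support Y (h : Y -> R) : Prop :=
  exists r : R, forall y, h y != 0 -> ball (base Y) r y.

(* Convergence is a property of the tail of the sequence, so the maps are
   required to be weak approximations for all large i only.  Asking for it at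
   every i, with the proviso 0 < e < r, would make the notion depend on the
   first terms: a star of 1000 half-lines, each with density 1/50, has no weak
   (r, e)-approximation at all to the half-line with density 20. *)
Definition wpmGH_cvg (X : nat -> ppmms R) L : Prop :=
  exists (r_ e_ : nat -> R) (psi : forall i, X i -> L),
    [/\ nondecreasing_seq r_ /\ (r_ @ \oo --> +oo),
        nonincreasing_seq e_ /\ (e_ @ \oo --> (0 : R)),
        (forall i, borel_map (psi i)),
        (\forall i \near \oo, weak_approx (r_ i) (e_ i) (psi i)) &
        (forall h : L -> R, continuous h ->
          (exists M : R, forall y, `|h y| <= M) -> bounded_support h ->
          (\int[pp_meas (X i)]_x (h (psi i x))%:E)%E @[i --> \oo]
            --> (\int[pp_meas L]_y (h y)%:E)%E)].

End Definitions.
Arguments spt {R} X _.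

(* Main.v *)
(* Uniform bound => limit: the distances d_k(phi_ik x, phi_jk y) decrease in k, so
   they converge to a pseudodistance on the disjoint union of the supports; the
   direct limit is the completion of its metric quotient, with the measure
   sup_i (f_i)_* m_i, where the image measures increase because the system
   consists of morphisms.  The balls are finite since the mass of the preimage
   of a ball around the base point under f_i is the limit of masses of balls of
   the same radius in later stages.  Conversely the ball of radius R in X_i is
   mapped into the one in the limit.

   Any direct limit L is isomorphic to this one on the supports, so it has the
   limit distances and the (setwise) limit measure.  Then the canonical maps
   f_j : X_j -> L are themselves the weak approximations. *)
Require Import Defs.
From HB Require Import structures.
From mathcomp Require Import all_boot all_order all_algebra.
From mathcomp Require Import all_classical all_reals all_analysis.
From mathcomp Require Import measurable_realfun lra.

Set Implicit Arguments.
Unset Strict Implicit.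
Unset Printing Implicit Defensive.

Import Order.TTheory GRing.Theory Num.Theory.
Import numFieldNormedType.Exports.

Local Open Scope classical_set_scope.
Local Open Scope ring_scope.

(** * Completion of a pseudometric *)

Record pseudodist (R : realType) (D : Type) := PseudoDist {
  pdist :> D -> D -> R ;
  pdistxx : forall a, pdist a a = 0 ;
  pdist_sym : forall a b, pdist a b = pdist b a ;
  pdist_triangle : forall b a c, pdist a c <= pdist a b + pdist b c }.

Lemma pdist_ge0 (R : realType) (D : Type) (d : pseudodist R D) a b : 0 <= d a b.
Proof.
have := pdist_triangle d b a a; rewrite pdistxx (pdist_sym d b a).
by lra.
Qed.

(* A point of the completion is encoded by its distance function to [D].  The
   parameter [a0] is only there to make the type canonically pointed. *)
Record completion (R : realType) (D : Type) (d : pseudodist R D) (a0 : D) :=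
  Completion {
    cfun : D -> R ;
    cfunP : forall e, 0 < e -> exists a, forall b, `|cfun b - d a b| <= e }.

Section completion.
Context {R : realType} {D : Type} (d : pseudodist R D) (a0 : D).
Local Notation C := (completion d a0).

HB.instance Definition _ := gen_eqMixin C.
HB.instance Definition _ := gen_choiceMixin C.

(** The uniform distance, as in the Kuratowski embedding; the functions may be unbounded, only their
    differences are bounded. *)
Definition cdist (g h : C) : R := sup (range (fun b => `|cfun g b - cfun h b|)).

(** Each function is within 1 of some [d a] or [d c], and these two differ by at most [d a c]; hence
    the bound [2 + d a c]. *)
Lemma cdist_has_sup (g h : C) :
  has_sup (range (fun b => `|cfun g b - cfun h b|)).
Proof.
split; first by exists (`|cfun g a0 - cfun h a0|); exists a0.
have [a ga] := cfunP g ltr01; have [c hc] := cfunP h ltr01.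
exists (2 + d a c) => _ [b _ <-].
have := ga b; have := hc b.
have := pdist_triangle d c a b; have := pdist_triangle d a c b.
rewrite (pdist_sym d c a) !ler_norml => *; apply/andP; split; lra.
Qed.

Lemma cdist_ub (g h : C) b : `|cfun g b - cfun h b| <= cdist g h.
Proof. by apply: ub_le_sup; [exact: (cdist_has_sup g h).2|exists b]. Qed.

Lemma cdist_le (g h : C) M :
  (forall b, `|cfun g b - cfun h b| <= M) -> cdist g h <= M.
Proof.
move=> gh; apply: ge_sup; first exact: (cdist_has_sup g h).1.
by move=> _ [b _ <-].
Qed.

Lemma cdistxx g : cdist g g = 0.
Proof.
apply/eqP; rewrite eq_le; apply/andP; split.
  by apply: cdist_le => b; rewrite subrr normr0.
by apply: le_trans (cdist_ub g g a0).
Qed.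

Lemma cdist_positivity g h : cdist g h = 0 -> g = h.
Proof.
move=> gh0; suff : cfun g = cfun h.
  case: g h {gh0} => [g gP] [h hP] /= gh; rewrite gh in gP *.
  by congr Completion; exact: Prop_irrelevance.
apply/funext => b; apply/eqP; rewrite -subr_eq0 -normr_le0.
by move: (cdist_ub g h b); rewrite gh0.
Qed.

Lemma cdist_sym g h : cdist g h = cdist h g.
Proof. by rewrite /cdist; congr sup; apply: eq_imagel => b _; rewrite distrC. Qed.

Lemma cdist_triangle h g k : cdist g k <= cdist g h + cdist h k.
Proof.
apply: cdist_le => b; apply: le_trans (ler_distD (cfun h b) _ _) _.
by apply: lerD; exact: cdist_ub.
Qed.

HB.instance Definition _ := isMetric.Build R C
  cdistxx cdist_positivity cdist_sym cdist_triangle.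

Lemma completion_embed_subproof a :
  forall e : R, 0 < e -> exists c, forall b, `|d a b - d c b| <= e.
Proof. by move=> e e0; exists a => b; rewrite subrr normr0 ltW. Qed.

(** Points at pseudodistance zero have the same distance function, so the metric quotient is taken
    implicitly. *)
Definition completion_embed a : C := Completion a0 (completion_embed_subproof a).

HB.instance Definition _ := isPointed.Build C (completion_embed a0).

(** The triangle inequality bounds the supremum by [d a b], and the value at [b] attains it. *)
Lemma mdist_completion_embed a b :
  mdist (completion_embed a) (completion_embed b) = d a b.
Proof.
apply/eqP; rewrite eq_le; apply/andP; split.
  apply: cdist_le => c /=; rewrite ler_norml.
  have := pdist_triangle d b a c; have := pdist_triangle d a b c.
  by rewrite (pdist_sym d b a) => *; apply/andP; split; lra.
apply: le_trans (cdist_ub _ _ b); rewrite /= pdistxx subr0.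
by rewrite ger0_norm// pdist_ge0.
Qed.

Lemma completion_embed_dense (g : C) e : 0 < e ->
  exists a, mdist g (completion_embed a) < e.
Proof.
move=> e0; have [a ga] := cfunP g (divr_gt0 e0 (ltr0Sn R 1)).
exists a; apply: (@le_lt_trans _ _ (e / 2)); last by lra.
exact: cdist_le.
Qed.

(** Real completeness gives a pointwise limit [G], which is then shown to be a uniform limit. *)
Lemma completion_cauchy_cvg (F : set_system C) :
  ProperFilter F -> cauchy F -> cvg F.
Proof.
move=> PF /cauchyP Fc.
have cvb b : cvg ((fun g : C => cfun g b : R^o) @ F).
  apply: cauchy_cvg; apply/cauchy_exP => e e0.
  have [g gF] := Fc _ e0; exists (cfun g b).
  change (F (fun h => ball (cfun g b : R^o) e (cfun h b))).
  apply: filterS gF => h; rewrite ballEmdist /= => gh.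
  rewrite (_ : ball _ _ _ = (`|cfun g b - cfun h b| < e)) //.
  exact: le_lt_trans (cdist_ub g h b) gh.
pose G b : R := lim ((fun g : C => cfun g b : R^o) @ F).
(* The bound does not depend on [b]: this makes [G] a point of the completion and yields convergence
   to it. *)
have GE (g : C) (e : R) b : F (ball g e) -> `|G b - cfun g b| <= e.
  move=> gF.
  apply: (@closed_cvg _ _ F _ (fun g : C => cfun g b : R^o)
    (fun r : R => `|r - cfun g b| <= e) _ _ (G b) (cvb b)).
    apply: (@closed_comp _ _ (fun r : R^o => `|r - cfun g b|) [set x | x <= e]).
      move=> x _; apply: cvg_norm; apply: cvgB; [exact: cvg_id|exact: cvg_cst].
    exact: closed_le.
  apply: filterS gF => h; rewrite ballEmdist /= => gh.
  by rewrite distrC ltW//; apply: le_lt_trans (cdist_ub _ _ b) gh.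
have GP e : 0 < e -> exists a, forall b, `|G b - d a b| <= e.
  move=> e0; have e20 : 0 < e / 2 by rewrite divr_gt0.
  have [g gF] := Fc _ e20; have [a ga] := cfunP g e20.
  exists a => b; apply: le_trans (ler_distD (cfun g b) _ _) _.
  rewrite [leRHS](splitr e); apply: lerD => //; exact: GE.
apply/cvg_ex; exists (Completion a0 GP : C).
apply/cvg_ballP => e e0.
have e30 : 0 < e / 3 by rewrite divr_gt0.
have [g gF] := Fc _ e30.
apply: filterS (gF) => h gh; rewrite ballEmdist /=.
move: (gh); rewrite ballEmdist /= => gh'.
apply: le_lt_trans (metric_triangle _ g _) _.
have : mdist (Completion a0 GP : C) g <= e / 3.
  apply: (@cdist_le (Completion a0 GP)) => b; exact: (GE g _ b gF).
by lra.
Qed.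

HB.instance Definition _ := Uniform_isComplete.Build C completion_cauchy_cvg.

Lemma completion_extend (Y : completeMetricType R) (psi : D -> Y) :
  (forall a b, mdist (psi a) (psi b) <= d a b) ->
  exists Phi : C -> Y, (forall a, Phi (completion_embed a) = psi a) /\
    forall g h, mdist (Phi g) (Phi h) <= mdist g h.
Proof.
move=> psil.
(* The value at [g] is the limit of [psi] along points of [D] approaching [g]. This inequality alone
   then gives both the agreement with [psi] and the Lipschitz bound. *)
have ex_lim (g : C) :
    exists y, forall a, mdist y (psi a) <= mdist g (completion_embed a).
  pose B e := [set psi a | a in [set a | mdist g (completion_embed a) < e]].
  pose F := filter_from [set e : R | 0 < e] B.
  have FF : ProperFilter F.
    apply: filter_from_proper.
      apply: filter_from_filter; first by exists 1 => /=.
      move=> e e' e0 e'0; exists (Num.min e e') => /=; first by rewrite lt_min e0.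
      by move=> _ [a /= ga <-]; move: ga; rewrite lt_min => /andP[ga ga'];
        split; exists a.
    by move=> e e0; have [a ga] := completion_embed_dense g e0; exists (psi a), a.
  have Fc : cauchy F.
    apply/cauchyP => e e0; have e20 : 0 < e / 2 by rewrite divr_gt0.
    have [a ga] := completion_embed_dense g e20.
    exists (psi a), (e / 2) => // _ [b /= gb <-]; rewrite ballEmdist /=.
    apply: le_lt_trans (psil a b) _; rewrite -mdist_completion_embed.
    apply: le_lt_trans (metric_triangle _ g _) _.
    by rewrite (splitr e) metric_sym; exact: ltrD.
  have [y Fy] := (cvg_ex F).1 (cauchy_cvg F Fc).
  exists y => a; apply/ler_addgt0Pl => e e0.
  have e20 : 0 < e / 2 by rewrite divr_gt0.
  have [e' /= e'0 Be'] : F (ball y (e / 2)) by apply: Fy; exact: nbhsx_ballx.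
  have m0 : 0 < Num.min (e / 2) e' by rewrite lt_min e20.
  have [b] := completion_embed_dense g m0; rewrite lt_min => /andP[gb gb'].
  have : ball y (e / 2) (psi b) by apply: Be'; exists b.
  rewrite ballEmdist /= => yb.
  have := metric_triangle y (psi b) (psi a); have := psil b a.
  rewrite -mdist_completion_embed.
  have := metric_triangle (completion_embed b) g (completion_embed a).
  by rewrite (metric_sym _ g); lra.
have [Phi PhiP] := choice ex_lim; exists Phi; split.
  move=> a; apply: mdist_positivity; apply/eqP; rewrite eq_le mdist_ge0 andbT.
  by apply: le_trans (PhiP _ a) _; rewrite mdist_completion_embed pdistxx.
move=> g h; apply/ler_addgt0Pl => e e0.
have e20 : 0 < e / 2 by rewrite divr_gt0.
have [a ga] := completion_embed_dense g e20.
have := metric_triangle (Phi g) (psi a) (Phi h); have := PhiP g a.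
have := PhiP h a; rewrite (metric_sym (Phi h)).
have := metric_triangle h g (completion_embed a); rewrite (metric_sym h g).
by lra.
Qed.

End completion.

(** * Supports and morphisms *)

Section metric.
Context {R : realType}.

Lemma metric_ball_open (T : metricType R) (x : T) (r : R) : open (ball x r).
Proof.
rewrite openE => y; rewrite ballEmdist /= => xy.
apply/nbhs_ballP; exists (r - mdist x y) => /=; first by rewrite subr_gt0.
move=> z; rewrite !ballEmdist /= => yz.
by apply: le_lt_trans (metric_triangle _ y _) _; lra.
Qed.

Lemma mdist_dist (T : metricType R) (x y z w : T) :
  `|mdist x y - mdist z w| <= mdist x z + mdist y w.
Proof.
have := metric_triangle x z y; have := metric_triangle z w y.
have := metric_triangle z x w; have := metric_triangle x y w.
rewrite (metric_sym z x) (metric_sym w y) ler_norml => *.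
by apply/andP; split; lra.
Qed.

Lemma exists_invS_lt (e : R) : 0 < e -> exists n : nat, n.+1%:R^-1 < e.
Proof.
move=> e0; exists (Num.truncn e^-1).
by rewrite invf_plt ?posrE ?ltr0Sn// truncnS_gt.
Qed.

(* A set inherits separability from the ambient space: pick a point of the set
   near each point of a dense sequence, at each scale. *)
Lemma separable_subset (T : metricType R) (D A : set T) (a : T) :
  countable D -> dense D -> A a ->
  exists s : nat -> T, (forall n, A (s n)) /\
    forall x e, A x -> 0 < e -> exists n, mdist x (s n) < e.
Proof.
move=> /countable_injP[f finj] dD Aa.
pose P (k : nat * nat) := [set y | A y /\
  exists2 z, D z /\ f z = k.1 & mdist z y < k.2.+1%:R^-1].
pose t k := xget a (P k).
have tA k : A (t k) by rewrite /t; case: xgetP => // y _ [].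
exists (fun n => t (odflt (0%N, 0%N) (unpickle n))); split => // x e Ax e0.
have [m me] := exists_invS_lt (divr_gt0 e0 (ltr0Sn R 1)).
have [z [xz Dz]] : (ball x m.+1%:R^-1 `&` D) !=set0.
  apply: dD; last exact: metric_ball_open.
  by exists x; apply: ballxx; rewrite invr_gt0 ltr0Sn.
exists (pickle (f z, m)); rewrite pickleK /=.
move: xz; rewrite ballEmdist /= => xz.
have : P (f z, m) (t (f z, m)).
  apply: xgetPex; exists x; split=> //; exists z => //.
  by rewrite metric_sym.
move=> [_ [w [Dw fw] wt]].
have wz : w = z by apply: finj; rewrite ?inE.
rewrite {}wz /= in wt.
apply: le_lt_trans (metric_triangle _ z _) _.
by rewrite (splitr e); apply: ltrD; [apply: lt_trans me|apply: lt_trans me].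
Qed.

End metric.

Section ppmms.
Context {R : realType}.
Implicit Types X Y Z : ppmms R.

Lemma open_measurable_borel X (U : set X) :
  open U -> measurable (U : set (borel X)).
Proof. by move=> oU; exact: (@sub_sigma_algebra _ setT (@open X) _ oU). Qed.

Lemma closed_measurable_borel X (U : set X) :
  closed U -> measurable (U : set (borel X)).
Proof.
move=> cU; rewrite -(setCK U); apply: measurableC.
by apply: open_measurable_borel; exact: closed_openC.
Qed.

Lemma measurable_ball_borel X (x : X) r : measurable (ball x r : set (borel X)).
Proof. by apply: open_measurable_borel; exact: metric_ball_open. Qed.

Lemma borel_map_preimage X Y (f : X -> Y) (B : set (borel Y)) :
  borel_map f -> measurable B -> measurable (f @^-1` B : set (borel X)).
Proof. by move=> mf mB; rewrite -[X in measurable X]setTI; exact: mf. Qed.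

Lemma spt_base X : spt X (base X).
Proof. exact: pp_base_spt. Qed.

Lemma spt_closed X : closed (spt X).
Proof.
rewrite -openC openE => x /= /existsNP[r /not_implyP[r0 xr]].
apply/nbhs_ballP; exists (r / 2) => /=; first exact: divr_gt0.
move=> y; rewrite ballEmdist /= => xy spty; apply: xr.
apply: lt_le_trans (spty _ (divr_gt0 r0 (ltr0Sn R 1))) _.
apply: le_measure; rewrite ?inE; [exact: measurable_ball_borel..|].
move=> z; rewrite !ballEmdist /= => yz.
by apply: le_lt_trans (metric_triangle _ y _) _; lra.
Qed.

Lemma measurable_spt X : measurable (spt X : set (borel X)).
Proof. by apply: closed_measurable_borel; exact: spt_closed. Qed.

Lemma spt_dense_seq X : exists s : nat -> X, (forall n, spt X (s n)) /\
  forall x e, spt X x -> 0 < e -> exists n, mdist x (s n) < e.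
Proof.
have [D cD dD] := pp_separable X.
exact: (separable_subset cD dD (spt_base X)).
Qed.

(** By separability, countably many null balls, with centers in a dense sequence and radii
    [1/(m+1)], cover the complement of the support. *)
Lemma setC_spt_null X : pp_meas X (~` spt X) = 0%E.
Proof.
have [D cD dD] := pp_separable X.
have [s [_ sd]] := separable_subset cD dD (I : setT (base X)).
pose B (k : nat * nat) : set (borel X) := ball (s k.1) k.2.+1%:R^-1.
(* Balls of positive mass, and integers that encode no pair, contribute the empty set. *)
pose F n := if unpickle n is Some k then
  if pp_meas X (B k) == 0%E then B k else set0 else set0.
have : (pp_meas X).-negligible (\bigcup_n F n).
  apply: negligible_bigcup => n; rewrite /F; case: unpickle => [k|]; last first.
    exact: negligible_set0.
  case: eqP => [Bk0|_]; last exact: negligible_set0.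
  by apply/negligibleP => //; exact: measurable_ball_borel.
move=> /negligibleS Fneg; apply/negligibleP; last apply: Fneg.
  by apply: measurableC; exact: measurable_spt.
move=> x /= /existsNP[r /not_implyP[r0 xr]].
have [m mr] := exists_invS_lt (divr_gt0 r0 (ltr0Sn R 1)).
have m0 : 0 < (m.+1%:R^-1 : R) by rewrite invr_gt0 ltr0Sn.
have [n xn] := sd x _ I m0.
exists (pickle (n, m)) => //; rewrite /F pickleK ifT; last first.
  rewrite -measure_le0 leNgt; apply/negP => Bgt0; apply: xr.
  apply: lt_le_trans Bgt0 _; apply: le_measure; rewrite ?inE.
  1,2: exact: measurable_ball_borel.
  move=> z; rewrite /B !ballEmdist /= => yz.
  apply: le_lt_trans (metric_triangle _ (s n) _) _; move: xn yz mr => /=.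
  by move: (m.+1%:R^-1 : R) => c; lra.
by rewrite /B ballEmdist /= metric_sym.
Qed.

(** Lets inclusions be checked on the support only, the one place where morphisms are controlled. *)
Lemma le_meas_spt X (A B : set (borel X)) : measurable A -> measurable B ->
  spt X `&` A `<=` B -> (pp_meas X A <= pp_meas X B)%E.
Proof.
move=> mA mB AB.
have mS : measurable (~` spt X : set (borel X)).
  by apply: measurableC; exact: measurable_spt.
rewrite -(measureU0 mB mS (setC_spt_null X)).
apply: le_measure; rewrite ?inE//; first exact: measurableU.
by move=> x Ax; have [Sx|nSx] := pselect (spt X x); [left; apply: AB|right].
Qed.

Lemma eq_meas_spt X (A B : set (borel X)) : measurable A -> measurable B ->
  (forall x, spt X x -> A x <-> B x) -> pp_meas X A = pp_meas X B.
Proof.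
move=> mA mB AB; apply/eqP; rewrite eq_le; apply/andP; split.
  by apply: le_meas_spt => // x [/AB ABx /ABx].
by apply: le_meas_spt => // x [/AB ABx /ABx].
Qed.

(** Up to a null set, the preimage of a ball around [f x] contains the ball of the same radius
    around [x], and the pushforward is dominated by the measure of [Y]. *)
Lemma morphism_spt X Y (f : X -> Y) x : is_morphism f -> spt X x -> spt Y (f x).
Proof.
move=> [mf fb fl fp] Sx r r0.
apply: lt_le_trans (Sx r r0) _.
apply: le_trans (fp _ (measurable_ball_borel (f x) r)).
apply: le_meas_spt; first exact: measurable_ball_borel.
  exact: borel_map_preimage mf (measurable_ball_borel _ _).
move=> y [Sy]; rewrite /= !ballEmdist /= => xy.
exact: le_lt_trans (fl _ _ Sx Sy) xy.
Qed.

Lemma morphism_id X : is_morphism (id : X -> X).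
Proof. by split => //; exact: measurable_id. Qed.

Lemma morphism_comp X Y Z (g : Y -> Z) (f : X -> Y) :
  is_morphism g -> is_morphism f -> is_morphism (g \o f).
Proof.
move=> gM fM; have [mg gb gl gp] := gM; have [mf fb fl fp] := fM; split.
- exact: measurableT_comp mg mf.
- by rewrite /= fb.
- move=> x y Sx Sy; apply: le_trans (fl _ _ Sx Sy).
  by apply: gl; exact: morphism_spt.
- move=> B mB; apply: le_trans (gp B mB).
  by apply: fp; exact: borel_map_preimage.
Qed.

(** The preimage of an open set is relatively open in the closed support, plus all or nothing of the
    complement. The codomain carries no measure, so that the lemma applies to the limit space before
    its measure exists. *)
Lemma borel_map_lipschitz X (Y : completeMetricType R) (f : X -> Y) :
  (forall x y, spt X x -> spt X y -> mdist (f x) (f y) <= mdist x y) ->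
  (forall x, ~ spt X x -> f x = point) ->
  measurable_fun [set: borel X] (f : borel X -> borel Y).
Proof.
move=> fl fb.
apply: (@measurability _ _ (borel X) (borel Y) setT f (@open Y)) => //.
move=> _ [U oU <-]; rewrite setTI.
(* An open set whose trace on the support is that of the preimage of [U]. *)
pose V : set X := [set y | exists x r, [/\ spt X x, ball (f x) r `<=` U &
  mdist x y < r]].
have oV : open V.
  rewrite openE => y [x [r [Sx xU xy]]].
  apply/nbhs_ballP; exists (r - mdist x y) => /=; first by rewrite subr_gt0.
  move=> z; rewrite ballEmdist /= => yz; exists x, r; split => //.
  by apply: le_lt_trans (metric_triangle _ y _) _; lra.
have [bU|nbU] := pselect (U (point : Y)).
  rewrite (_ : f @^-1` U = V `|` ~` spt X).
    by apply: measurableU; [exact: open_measurable_borel|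
      by apply: measurableC; exact: measurable_spt].
  apply/seteqP; split => x /=.
    have [Sx Ufx|nSx _] := pselect (spt X x); [left|by right].
    have /nbhs_ballP[r /= r0 rU] := open_nbhs_nbhs (conj oU Ufx).
    by exists x, r; split => //; rewrite mdistxx.
  move=> [[y [r [Sy yU yx]]]|/fb -> //].
  have [Sx|/fb -> //] := pselect (spt X x).
  by apply: yU; rewrite ballEmdist /=; apply: le_lt_trans (fl _ _ Sy Sx) yx.
rewrite (_ : f @^-1` U = V `&` spt X).
  by apply: measurableI; [exact: open_measurable_borel|exact: measurable_spt].
apply/seteqP; split => x /=.
  have [Sx Ufx|/fb -> //] := pselect (spt X x); split => //.
  have /nbhs_ballP[r /= r0 rU] := open_nbhs_nbhs (conj oU Ufx).
  by exists x, r; split => //; rewrite mdistxx.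
move=> [[y [r [Sy yU yx]]] Sx].
by apply: yU; rewrite ballEmdist /=; apply: le_lt_trans (fl _ _ Sy Sx) yx.
Qed.

End ppmms.

(** * Setwise limits of measures *)

Section sup_measure.
Local Open Scope ereal_scope.
Context d (T : measurableType d) (R : realType).
Variable nu : nat -> {measure set T -> \bar R}.

Definition nondecreasing_measures : Prop :=
  forall A, measurable A -> nondecreasing_seq (fun i => nu i A).

(** The monotonicity proof is an argument so that the measure structure can be attached to
    [sup_measure nd]. *)
Definition sup_measure of nondecreasing_measures : set T -> \bar R :=
  fun A => ereal_sup (range (fun i => nu i A)).

Hypothesis nd : nondecreasing_measures.

Lemma sup_measure_cvg A : measurable A ->
  nu i A @[i --> \oo] --> sup_measure nd A.
Proof. by move=> mA; apply: ereal_nondecreasing_cvgn; exact: nd. Qed.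

Lemma sup_measure_ge i A : nu i A <= sup_measure nd A.
Proof. by apply: ereal_sup_ubound; exists i. Qed.

Lemma sup_measure0 : sup_measure nd set0 = 0.
Proof.
rewrite -[RHS]ereal_sup1; congr ereal_sup; apply/seteqP.
split => [_ [i _ <-]|_ ->]; first by rewrite measure0.
by exists 0%N; rewrite ?measure0.
Qed.

Lemma sup_measure_ge0 A : 0 <= sup_measure nd A.
Proof. exact: le_trans (measure_ge0 (nu 0%N) A) (sup_measure_ge 0 A). Qed.

(** One inequality is termwise; for the other, the limit in [i] commutes with finite partial
    sums. *)
Lemma sup_measure_sigma_additive : semi_sigma_additive (sup_measure nd).
Proof.
move=> F mF tF mUF.
rewrite (_ : sup_measure nd _ = \sum_(k <oo) sup_measure nd (F k)).
  by apply: is_cvg_nneseries => k _ _; exact: sup_measure_ge0.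
apply/eqP; rewrite eq_le; apply/andP; split.
  apply: ge_ereal_sup => _ [i _ <-]; rewrite measure_semi_bigcup//.
  by apply: lee_nneseries => [k _ _|k _]; [exact: measure_ge0|exact: sup_measure_ge].
apply: lime_le.
  by apply: is_cvg_nneseries => k _ _; exact: sup_measure_ge0.
apply: nearW => n.
have cvs : \sum_(0 <= k < n) nu i (F k) @[i --> \oo] -->
    \sum_(0 <= k < n) sup_measure nd (F k).
  apply: cvg_nnesum => k _; first by apply: nearW => i; exact: measure_ge0.
  exact: sup_measure_cvg.
rewrite -(cvg_lim _ cvs)//; apply: lime_le.
  by apply/cvg_ex; eexists; exact: cvs.
apply: nearW => i; apply: le_trans (sup_measure_ge i _).
rewrite measure_semi_bigcup//; apply: nneseries_lim_ge => k _ _.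
exact: measure_ge0.
Qed.

HB.instance Definition _ := isMeasure.Build _ _ _ (sup_measure nd)
  sup_measure0 sup_measure_ge0 sup_measure_sigma_additive.

End sup_measure.

Section setwise_cvg.
Context d (T : measurableType d) (R : realType).

(* Apply monotonicity of the integral in the measure to [M + h] and [M - h]
   on [B]. *)
Lemma setwise_cvg_integral (nu : nat -> {measure set T -> \bar R})
    (m : {measure set T -> \bar R}) (h : T -> R) (B : set T) (M : R) :
  (forall i A, measurable A -> (nu i A <= m A)%E) ->
  (nu i B @[i --> \oo] --> m B)%E ->
  measurable_fun [set: T] h -> (forall x, `|h x| <= M) ->
  measurable B -> (forall x, ~ B x -> h x = 0) -> (m B < +oo)%E ->
  (\int[nu i]_x (h x)%:E @[i --> \oo] --> \int[m]_x (h x)%:E)%E.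
Proof.
move=> num cvB mh hM mB hB mBoo.
have restr (mu : {measure set T -> \bar R}) :
    (\int[mu]_x (h x)%:E = \int[mu]_(x in B) (h x)%:E)%E.
  rewrite [RHS]integral_mkcond; apply: eq_integral => x _; rewrite patchE.
  by case: ifPn => // /negP; rewrite inE => /hB ->.
have hI (mu : {measure set T -> \bar R}) : (mu B < +oo)%E ->
    mu.-integrable B (EFin \o h).
  move=> muB; apply: measurable_bounded_integrable => //.
    exact: measurable_funTS.
  exists M; split; first exact: num_real.
  by move=> N MN x _; apply: le_trans (hM x) (ltW MN).
have MI (mu : {measure set T -> \bar R}) : (mu B < +oo)%E ->
    mu.-integrable B (EFin \o cst M).
  move=> muB; apply: measurable_bounded_integrable => //.
  exists `|M|; split; first exact: num_real.
  by move=> N MN x _; exact: ltW.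
pose I (mu : {measure set T -> \bar R}) := fine (\int[mu]_(x in B) (h x)%:E)%E.
have intE (mu : {measure set T -> \bar R}) : (mu B < +oo)%E ->
    (\int[mu]_(x in B) (h x)%:E = (I mu)%:E)%E.
  by move=> muB; rewrite fineK//; apply: integrable_fin_num => //; exact: hI.
have muBE (mu : {measure set T -> \bar R}) : (mu B < +oo)%E ->
    mu B = (fine (mu B))%:E.
  by move=> muB; rewrite fineK// ge0_fin_numE.
have intD (mu : {measure set T -> \bar R}) : (mu B < +oo)%E ->
    (\int[mu]_(x in B) ((M + h x)%R%:E) = (M * fine (mu B) + I mu)%R%:E)%E.
  move=> muB; under eq_integral do rewrite EFinD.
  rewrite (@integralD _ _ _ mu B mB (EFin \o cst M) (EFin \o h)) ?hI ?MI//.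
  by rewrite /= integral_cst// intE// [in LHS]muBE// -EFinM -EFinD.
have intBh (mu : {measure set T -> \bar R}) : (mu B < +oo)%E ->
    (\int[mu]_(x in B) ((M - h x)%R%:E) = (M * fine (mu B) - I mu)%R%:E)%E.
  move=> muB; under eq_integral do rewrite EFinB.
  rewrite (@integralB _ _ _ mu B mB (EFin \o cst M) (EFin \o h)) ?hI ?MI//.
  by rewrite /= integral_cst// intE// [in LHS]muBE// -EFinM -EFinB.
have nuB i : (nu i B < +oo)%E by apply: le_lt_trans (num i _ mB) mBoo.
rewrite restr intE//; under eq_fun do rewrite restr intE//.
apply: cvg_EFin; first by apply: nearW.
have cvB' : fine (nu i B) @[i --> \oo] --> fine (m B).
  by apply: fine_cvg; rewrite -muBE.
apply/cvgrPdist_le => e e0.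
have M0 : 0 <= M by apply: le_trans (hM point).
(* The denominator is [M + 1] because [M] may be zero. *)
have e1 : 0 < e / (M + 1) by apply: divr_gt0 => //; lra.
move/cvgrPdist_le : cvB' => /(_ _ e1); apply: filterS => i.
have le1 : I (nu i) + M * fine (nu i B) <= I m + M * fine (m B).
  rewrite addrC [leRHS]addrC -lee_fin -!intD//.
  apply: ge0_le_measure_integral => //; first by move=> A mA; exact: num.
    by move=> x; rewrite lee_fin; have := hM x; rewrite ler_norml; lra.
  by apply/measurable_EFinP; apply: measurable_funD.
have le2 : M * fine (nu i B) - I (nu i) <= M * fine (m B) - I m.
  rewrite -lee_fin -!intBh//.
  apply: ge0_le_measure_integral => //; first by move=> A mA; exact: num.
    by move=> x; rewrite lee_fin; have := hM x; rewrite ler_norml; lra.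
  by apply/measurable_EFinP; apply: measurable_funB.
(* Together, [le1] and [le2] bound the difference of the integrals by [M] times the mass still
   missing from [B]. *)
move=> dB; apply: (@le_trans _ _ (M * (fine (m B) - fine (nu i B)))).
  by rewrite ler_norml /comp /=; apply/andP; split; lra.
apply: le_trans (ler_wpM2l M0 (ler_norm _)) _.
apply: le_trans (ler_wpM2l M0 dB) _.
have M1 : 0 < M + 1 by lra.
rewrite mulrCA; apply: ler_piMr; first exact: ltW.
by rewrite ler_pdivrMr// mul1r; lra.
Qed.

End setwise_cvg.

Section image_measure.
Context d1 d2 (T1 : measurableType d1) (T2 : measurableType d2) (R : realType).

Definition image_measure (m : {measure set T1 -> \bar R}) (f : T1 -> T2)
    (mf : measurable_fun setT f) : {measure set T2 -> \bar R} :=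
  @measure_function_pushforward__canonical__measure_function_Measure
    _ _ _ _ _ m f mf.

(** The change of variables for a signed function asks for integrability: [h \o f] is bounded and
    vanishes outside a set of finite mass. *)
Lemma bounded_integral_image_measure (m : {measure set T1 -> \bar R})
    (f : T1 -> T2) (mf : measurable_fun setT f) (h : T2 -> R) (B : set T2)
    (M : R) :
  measurable_fun [set: T2] h -> (forall x, `|h x| <= M) ->
  measurable B -> (forall x, ~ B x -> h x = 0) ->
  (m (f @^-1` B) < +oo)%E ->
  (\int[image_measure m mf]_y (h y)%:E = \int[m]_x (h (f x))%:E)%E.
Proof.
move=> mh hM mB hB fin; rewrite /image_measure /=.
rewrite (integral_pushforward mf)//; first exact/measurable_EFinP.
have mfB : measurable (f @^-1` B).
  by rewrite -[X in measurable X]setTI; exact: mf.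
rewrite preimage_setT (_ : _ \o f = (EFin \o (h \o f)) \_ (f @^-1` B)).
  apply/(integrable_mkcond _ mfB); apply: measurable_bounded_integrable => //.
    by apply: measurable_funTS; apply: measurableT_comp.
  exists M; split; first exact: num_real.
  by move=> N MN x _; apply: le_trans (hM (f x)) (ltW MN).
apply/funext => x; rewrite patchE /=; case: ifPn => // /negP.
by rewrite inE /= => /hB ->.
Qed.

End image_measure.

(** * Construction of the direct limit *)

Section direct_system.
Context {R : realType} (X : nat -> ppmms R).
Variable phi : forall i j : nat, (i <= j)%N -> X i -> X j.
Hypothesis Hphi : is_direct_system phi.

(* The transition map as a total function of its indices, with junk value the
   base point when [j < i]. *)
Definition trans (i j : nat) (x : X i) : X j :=
  if Bool.bool_dec (i <= j)%N true is left ij then phi ij x else base (X j).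

Lemma transE i j (ij : (i <= j)%N) : trans j = phi ij.
Proof.
apply/funext => x; rewrite /trans; case: Bool.bool_dec => // ij'.
by rewrite (bool_irrelevance ij' ij).
Qed.

Lemma trans_morphism i j : (i <= j)%N -> is_morphism (@trans i j).
Proof. by move=> ij; rewrite transE; have [] := Hphi. Qed.

Lemma trans_base i j : (i <= j)%N -> trans j (base (X i)) = base (X j).
Proof. by move=> /trans_morphism []. Qed.

Lemma trans_spt i j (x : X i) : (i <= j)%N -> spt (X i) x -> spt (X j) (trans j x).
Proof. by move=> /trans_morphism; exact: morphism_spt. Qed.

Lemma trans_id i (x : X i) : spt (X i) x -> trans i x = x.
Proof.
by move=> Sx; rewrite (transE (leqnn i)); have [_ H _] := Hphi; rewrite H// inE.
Qed.

Lemma trans_trans i j k (x : X i) : (i <= j)%N -> (j <= k)%N -> spt (X i) x ->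
  trans k (trans j x) = trans k x.
Proof.
move=> ij jk Sx; have [_ _ H] := Hphi.
by rewrite (transE (leq_trans ij jk)) (H _ _ _ ij jk) ?inE// (transE ij) (transE jk).
Qed.

Lemma trans_lipschitz i j (x y : X i) : (i <= j)%N -> spt (X i) x ->
  spt (X i) y -> mdist (trans j x) (trans j y) <= mdist x y.
Proof. by move=> /trans_morphism [_ _ H _]; exact: H. Qed.

Lemma measurable_trans i j (B : set (borel (X j))) : (i <= j)%N ->
  measurable B -> measurable (@trans i j @^-1` B : set (borel (X i))).
Proof. by move=> /trans_morphism [mf _ _ _]; exact: borel_map_preimage. Qed.

(* The distances at stage [k] decrease with [k], so this is their limit. *)
Definition lim_dist i j (x : X i) (y : X j) : R :=
  inf [set mdist (trans k x) (trans k y) | k in [set k | (i <= k)%N /\ (j <= k)%N]].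

Lemma lim_dist_has_inf i j (x : X i) (y : X j) :
  has_inf [set mdist (trans k x) (trans k y) | k in [set k | (i <= k)%N /\ (j <= k)%N]].
Proof.
split; last by exists 0 => _ [k _ <-]; exact: mdist_ge0.
exists (mdist (trans (maxn i j) x) (trans (maxn i j) y)).
by exists (maxn i j); rewrite //= leq_maxl leq_maxr.
Qed.

Lemma lim_dist_le k i j (x : X i) (y : X j) : (i <= k)%N -> (j <= k)%N ->
  lim_dist x y <= mdist (trans k x) (trans k y).
Proof.
move=> ik jk; apply: ge_inf; last by exists k.
by have [] := lim_dist_has_inf x y.
Qed.

Lemma le_lim_dist i j (x : X i) (y : X j) c :
  (forall k, (i <= k)%N -> (j <= k)%N -> c <= mdist (trans k x) (trans k y)) ->
  c <= lim_dist x y.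
Proof.
move=> H; apply: lb_le_inf; first by have [] := lim_dist_has_inf x y.
by move=> _ [k [ik jk] <-]; exact: H.
Qed.

Lemma lim_dist_ge0 i j (x : X i) (y : X j) : 0 <= lim_dist x y.
Proof. by apply: le_lim_dist => k _ _; exact: mdist_ge0. Qed.

(** Some stage is already below [c], and later distances are no larger since transition maps are
    1-Lipschitz on supports. *)
Lemma lim_dist_lt i j (x : X i) (y : X j) c :
  spt (X i) x -> spt (X j) y -> lim_dist x y < c ->
  exists K, [/\ (i <= K)%N, (j <= K)%N &
    forall k, (K <= k)%N -> mdist (trans k x) (trans k y) < c].
Proof.
move=> Sx Sy xyc; have [_ [K [iK jK] <-] Kc] := inf_lt (lim_dist_has_inf x y).1 xyc.
exists K; split => // k Kk; apply: le_lt_trans Kc.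
rewrite -(trans_trans iK Kk Sx) -(trans_trans jK Kk Sy).
by apply: trans_lipschitz => //; exact: trans_spt.
Qed.

Lemma lim_dist_sym i j (x : X i) (y : X j) : lim_dist x y = lim_dist y x.
Proof.
rewrite /lim_dist; congr inf; apply/seteqP.
by split => _ [k [ik jk] <-]; exists k => //; rewrite metric_sym.
Qed.

Lemma lim_dist_triangle i j k (x : X i) (y : X j) (z : X k) :
  spt (X i) x -> spt (X j) y -> spt (X k) z ->
  lim_dist x z <= lim_dist x y + lim_dist y z.
Proof.
move=> Sx Sy Sz; apply/ler_addgt0Pl => e e0.
have e20 : 0 < e / 2 by rewrite divr_gt0.
have lt1 : lim_dist x y < lim_dist x y + e / 2 by lra.
have lt2 : lim_dist y z < lim_dist y z + e / 2 by lra.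
have [K [iK jK KP]] := lim_dist_lt Sx Sy lt1.
have [N [jN kN NP]] := lim_dist_lt Sy Sz lt2.
have := KP _ (leq_maxl K N); have := NP _ (leq_maxr K N).
have := lim_dist_le x z (leq_trans iK (leq_maxl K N)) (leq_trans kN (leq_maxr K N)).
have := metric_triangle (trans (maxn K N) x) (trans (maxn K N) y) (trans (maxn K N) z).
by lra.
Qed.

Lemma lim_dist_trans i j (x : X i) : (i <= j)%N -> spt (X i) x ->
  lim_dist x (trans j x) = 0.
Proof.
move=> ij Sx; apply/eqP; rewrite eq_le lim_dist_ge0 andbT.
apply: le_trans (lim_dist_le _ _ ij (leqnn j)) _.
by rewrite (trans_trans ij (leqnn j) Sx) mdistxx.
Qed.

Lemma lim_dist_le_mdist i (x y : X i) : spt (X i) x -> spt (X i) y ->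
  lim_dist x y <= mdist x y.
Proof.
move=> Sx Sy; apply: le_trans (lim_dist_le _ _ (leqnn i) (leqnn i)) _.
by rewrite !trans_id.
Qed.

Lemma trans_ball i j k (x : X i) r : (i <= j)%N -> (j <= k)%N -> spt (X i) x ->
  ball (base (X j)) r (trans j x) -> ball (base (X k)) r (trans k x).
Proof.
move=> ij jk Sx; rewrite !ballEmdist /= -(trans_base jk) -(trans_trans ij jk Sx).
by apply: le_lt_trans; apply: trans_lipschitz => //; [exact: spt_base|exact: trans_spt].
Qed.

(* The points of [X i] whose limit in the direct limit lies in the open
   [r]-ball around the base point. *)
Definition lim_ball i r : set (borel (X i)) :=
  [set x | spt (X i) x /\ lim_dist (base (X i)) x < r].

(** The infimum is below [r] exactly when some stage is. Writing stages as [i + n] keeps them after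
    [i]; the countable union shows that the set is Borel. *)
Lemma lim_ballE i r : lim_ball r =
  \bigcup_n (spt (X i) `&` @trans i (i + n) @^-1` ball (base (X (i + n))) r).
Proof.
apply/seteqP; split => [x [Sx xr]|x [n _ [Sx]]].
  have [K [iK _ KP]] := lim_dist_lt (spt_base (X i)) Sx xr.
  exists (K - i)%N => //; split => //=; rewrite ballEmdist /=.
  by rewrite -(@trans_base i) ?leq_addr// KP// -leq_subLR.
rewrite /= ballEmdist /= => xr; split => //.
apply: le_lt_trans (lim_dist_le _ _ (leq_addr n i) (leq_addr n i)) _.
by rewrite trans_base ?leq_addr.
Qed.

Lemma measurable_lim_ball i r : measurable (lim_ball r : set (borel (X i))).
Proof.
rewrite lim_ballE; apply: bigcupT_measurable => n; apply: measurableI.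
  exact: measurable_spt.
apply: measurable_trans; [exact: leq_addr|exact: measurable_ball_borel].
Qed.

(** Transition maps fix base points and do not increase distances on supports, so the union in
    [lim_ballE] is increasing and continuity from below applies. *)
Lemma lim_ball_cvg i r :
  (pp_meas (X i) (@trans i (i + n) @^-1` ball (base (X (i + n))) r)
    @[n --> \oo] --> pp_meas (X i) (lim_ball r))%E.
Proof.
have mE n : measurable
    (@trans i (i + n) @^-1` ball (base (X (i + n))) r : set (borel (X i))).
  by apply: measurable_trans; [exact: leq_addr|exact: measurable_ball_borel].
pose E n : set (borel (X i)) :=
  spt (X i) `&` @trans i (i + n) @^-1` ball (base (X (i + n))) r.
have mE' n : measurable (E n).
  by apply: measurableI; [exact: measurable_spt|exact: mE].
rewrite lim_ballE (_ : (fun n => _) = pp_meas (X i) \o E).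
  apply: nondecreasing_cvg_mu => //; first exact: bigcupT_measurable.
  move=> m n mn; apply/subsetPset => x [Sx xr]; split => //.
  by apply: trans_ball xr => //; [exact: leq_addr|rewrite leq_add2l].
apply/funext => n /=; apply: eq_meas_spt => // x Sx.
by split => [Bx|[]//]; split.
Qed.

Lemma le_lim_ball_meas i r (C : \bar R) :
  (forall j, pp_meas (X j) (ball (base (X j)) r) <= C)%E ->
  (pp_meas (X i) (lim_ball r) <= C)%E.
Proof.
move=> H; rewrite -(cvg_lim _ (@lim_ball_cvg i r))//; apply: lime_le.
  by apply/cvg_ex; eexists; exact: lim_ball_cvg.
apply: nearW => n; apply: le_trans (H (i + n)%N).
have [_ _ _] := trans_morphism (leq_addr n i); apply.
exact: measurable_ball_borel.
Qed.

(** * The limit space, its canonical maps and its measure *)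

Record spt_point := SptPoint {
  sp_index : nat ; sp_val : X sp_index ; sp_spt : spt (X sp_index) sp_val }.

Lemma lim_dist_xx (a : spt_point) : lim_dist (sp_val a) (sp_val a) = 0.
Proof.
apply/eqP; rewrite eq_le lim_dist_ge0 andbT.
rewrite -[leRHS](mdistxx (sp_val a)).
by apply: lim_dist_le_mdist; exact: sp_spt.
Qed.

Lemma lim_dist_spt_triangle (b a c : spt_point) :
  lim_dist (sp_val a) (sp_val c) <=
  lim_dist (sp_val a) (sp_val b) + lim_dist (sp_val b) (sp_val c).
Proof. by apply: lim_dist_triangle; exact: sp_spt. Qed.

(** Restricted to the supports, where the triangle inequality for [lim_dist] is available. *)
Definition system_dist : pseudodist R spt_point :=
  PseudoDist lim_dist_xx (fun a b => lim_dist_sym (sp_val a) (sp_val b))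
    lim_dist_spt_triangle.

Definition limit_space : completeMetricType R :=
  completion system_dist (SptPoint (spt_base (X 0))).

(** The constant value off the support is what [borel_map_lipschitz] asks for. *)
Definition to_limit i (x : X i) : limit_space :=
  if pselect (spt (X i) x) is left Sx then
    completion_embed _ _ (SptPoint Sx) else point.

Lemma to_limitE (a : spt_point) :
  to_limit (sp_val a) = completion_embed system_dist (SptPoint (spt_base (X 0))) a.
Proof.
rewrite /to_limit; case: pselect => [Sx|/(_ (sp_spt a))//].
by case: a Sx => i x Sx Sx' /=; congr completion_embed; congr SptPoint;
  exact: Prop_irrelevance.
Qed.

Lemma mdist_to_limit i j (x : X i) (y : X j) : spt (X i) x -> spt (X j) y ->
  mdist (to_limit x) (to_limit y) = lim_dist x y.
Proof.
move=> Sx Sy; rewrite (to_limitE (SptPoint Sx)) (to_limitE (SptPoint Sy)).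
exact: mdist_completion_embed.
Qed.

Lemma to_limit_dense (g : limit_space) e : 0 < e ->
  exists i (x : X i), spt (X i) x /\ mdist g (to_limit x) < e.
Proof.
move=> e0; have [a ga] := completion_embed_dense g e0.
by exists (sp_index a), (sp_val a); rewrite to_limitE; split => //; exact: sp_spt.
Qed.

Lemma to_limit_trans i j (x : X i) : (i <= j)%N -> spt (X i) x ->
  to_limit (trans j x) = to_limit x.
Proof.
move=> ij Sx; apply/esym/mdist_positivity.
by rewrite mdist_to_limit// ?lim_dist_trans//; exact: trans_spt.
Qed.

Lemma to_limit_base i : to_limit (base (X i)) = point.
Proof.
rewrite -(trans_base (leq0n i)) to_limit_trans//; last exact: spt_base.
exact: (to_limitE (SptPoint (spt_base (X 0)))).
Qed.

Lemma to_limit_lipschitz i (x y : X i) : spt (X i) x -> spt (X i) y ->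
  mdist (to_limit x) (to_limit y) <= mdist x y.
Proof. by move=> Sx Sy; rewrite mdist_to_limit// lim_dist_le_mdist. Qed.

Lemma measurable_to_limit i :
  measurable_fun [set: borel (X i)] (@to_limit i : borel (X i) -> borel limit_space).
Proof.
apply: borel_map_lipschitz; first exact: to_limit_lipschitz.
by move=> x nSx; rewrite /to_limit; case: pselect.
Qed.

Definition limit_image_measure i : {measure set (borel limit_space) -> \bar R} :=
  image_measure (pp_meas (X i)) (@measurable_to_limit i).

Lemma limit_image_measure_nd : nondecreasing_measures limit_image_measure.
Proof.
move=> B mB i j ij.
have mf k : measurable (@to_limit k @^-1` B : set (borel (X k))).
  by rewrite -[X in measurable X]setTI; exact: measurable_to_limit.
have [_ _ _ tp] := trans_morphism ij.
apply: le_trans (tp _ (mf j)).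
apply: le_meas_spt => //; first exact: measurable_trans.
by move=> x [Sx]; rewrite /= to_limit_trans.
Qed.

Definition limit_measure : {measure set (borel limit_space) -> \bar R} :=
  sup_measure limit_image_measure_nd.

Lemma limit_separable : exists2 D : set limit_space, countable D & dense D.
Proof.
pose s i := sval (cid (spt_dense_seq (X i))).
have sP i := svalP (cid (spt_dense_seq (X i))); rewrite -/(s _) in sP.
pose u (k : nat * nat) : limit_space := to_limit (s k.1 k.2).
exists (range u).
  by apply: card_le_trans (card_image_le _ _) _; exact: countableP.
move=> U [g Ug] oU.
have /nbhs_ballP[r /= r0 rU] := open_nbhs_nbhs (conj oU Ug).
have r20 : 0 < r / 2 by rewrite divr_gt0.
have [i [x [Sx gx]]] := to_limit_dense g r20.
have [sS sd] := sP i; have [n xn] := sd _ _ Sx r20.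
exists (u (i, n)); split; last by exists (i, n).
apply: rU; rewrite ballEmdist /=.
apply: le_lt_trans (metric_triangle _ (to_limit x) _) _; rewrite (splitr r).
by apply: ltrD => //; apply: le_lt_trans (to_limit_lipschitz Sx (sS n)) xn.
Qed.

(** Every point of the limit is in the support: it is near some [to_limit x], and a small ball
    around [x] has positive mass and lands in the given ball. *)
Lemma limit_spt (g : limit_space) r : 0 < r ->
  (0 < limit_measure (ball g r : set (borel limit_space)))%E.
Proof.
move=> r0; have r20 : 0 < r / 2 by rewrite divr_gt0.
have [i [x [Sx gx]]] := to_limit_dense g r20.
apply: lt_le_trans (Sx _ r20) _.
apply: le_trans (sup_measure_ge limit_image_measure_nd i _).
apply: le_meas_spt.
- exact: measurable_ball_borel.
- rewrite -[X in measurable X]setTI; apply: measurable_to_limit => //.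
  by apply: sub_sigma_algebra; exact: metric_ball_open.
move=> y [Sy]; rewrite /= !ballEmdist /= => xy.
apply: le_lt_trans (metric_triangle _ (to_limit x) _) _; rewrite (splitr r).
by apply: ltrD => //; apply: le_lt_trans (to_limit_lipschitz Sx Sy) xy.
Qed.

(** * Finiteness on balls and the universal property *)

Hypothesis ubf : unif_boundedly_finite X.

(** A point sent near the base point of the limit may be far from the base point of [X i] and come
    close only at later stages; hence the detour through [lim_ball]. *)
Lemma limit_ball_fin (g : limit_space) r :
  (limit_measure (ball g r : set (borel limit_space)) < +oo)%E.
Proof.
(* The ball around [g] fits in this one around the base point; the absolute value and the 1 keep the
   radius positive for every [r]. *)
pose r' := `|r| + mdist g point + 1.
have r'0 : 0 < r'.
  by rewrite /r'; have := mdist_ge0 g point; have := normr_ge0 r; lra.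
apply: le_lt_trans (ubf r'0); apply: ge_ereal_sup => _ [i _ <-].
apply: (@le_trans _ _ (pp_meas (X i) (lim_ball r'))).
  apply: le_meas_spt.
  - rewrite -[X in measurable X]setTI; apply: measurable_to_limit => //.
    by apply: sub_sigma_algebra; exact: metric_ball_open.
  - exact: measurable_lim_ball.
  move=> x [Sx]; rewrite /= ballEmdist /= => gx; split => //.
  rewrite -mdist_to_limit//; last exact: spt_base.
  rewrite to_limit_base; apply: le_lt_trans (metric_triangle _ g _) _.
  by rewrite /r' (metric_sym point); have := ler_norm r; lra.
by apply: le_lim_ball_meas => j; apply: ereal_sup_ubound; exists j.
Qed.

Definition limit_ppmms : ppmms R :=
  Ppmms (pp_meas := limit_measure) limit_separable limit_ball_fin
    (limit_spt point).

Lemma to_limit_morphism i : is_morphism (@to_limit i : X i -> limit_ppmms).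
Proof.
split.
- exact: measurable_to_limit.
- exact: to_limit_base.
- exact: to_limit_lipschitz.
- by move=> B _; exact: sup_measure_ge.
Qed.

Lemma to_limit_target : is_target phi (@to_limit : forall i, X i -> limit_ppmms).
Proof.
split; first exact: to_limit_morphism.
by move=> i j ij x; rewrite inE /= -transE => Sx; rewrite to_limit_trans.
Qed.

Lemma to_limit_direct_limit :
  is_direct_limit phi (@to_limit : forall i, X i -> limit_ppmms).
Proof.
split; first exact: to_limit_target.
move=> Y psi [psiM psiE].
have psi_trans i j (x : X i) : (i <= j)%N -> spt (X i) x ->
    psi i x = psi j (trans j x).
  by move=> ij Sx; rewrite (transE ij) (psiE _ _ ij)// inE.
have [a b|Phi [PhiE PhiL]] :=
    @completion_extend _ _ system_dist (SptPoint (spt_base (X 0))) Y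
      (fun a => psi _ (sp_val a)).
  (* At each common stage [k] the morphism [psi k] is 1-Lipschitz on the support, so [psi] is
     1-Lipschitz for the limit pseudodistance. *)
  apply: le_lim_dist => k ak bk.
  rewrite (psi_trans _ _ _ ak (sp_spt a)) (psi_trans _ _ _ bk (sp_spt b)).
  have [_ _ pl _] := psiM k.
  by apply: pl; apply: trans_spt => //; exact: sp_spt.
have PhiE' i (x : X i) : spt (X i) x -> Phi (to_limit x) = psi i x.
  by move=> Sx; rewrite (to_limitE (SptPoint Sx)) PhiE.
have mPhi : borel_map (Phi : limit_ppmms -> Y).
  apply: (@borel_map_lipschitz _ limit_ppmms Y) => [x y _ _|x]; first exact: PhiL.
  (* The condition off the support is vacuous. *)
  by case => r; exact: limit_spt.
exists Phi; split.
- split => //.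
  + rewrite /base -(to_limit_base 0) PhiE'; last exact: spt_base.
    by have [_ + _ _] := psiM 0%N.
  + move=> B mB; apply: ge_ereal_sup => _ [i _ <-].
    have [mpsi _ _ pp] := psiM i.
    apply: le_trans (pp _ mB); apply: le_meas_spt.
    * rewrite -[X in measurable X]setTI; apply: measurable_to_limit => //.
      exact: (@borel_map_preimage _ limit_ppmms).
    * exact: borel_map_preimage.
    * by move=> x [Sx]; rewrite /= PhiE'.
- by move=> i x; rewrite inE /= => Sx; rewrite PhiE'.
(* Two 1-Lipschitz maps agreeing on the dense images of the supports coincide. *)
- move=> Phi' [_ _ Pl _] Phi'E g _.
  apply: mdist_positivity; apply/eqP; rewrite eq_le mdist_ge0 andbT.
  apply/ler_addgt0Pl => e e0; have e20 : 0 < e / 2 by rewrite divr_gt0.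
  have [i [x [Sx gx]]] := to_limit_dense g e20.
  have : Phi' (to_limit x) = Phi (to_limit x).
    by rewrite PhiE'//; have := Phi'E i x; rewrite inE => /(_ Sx).
  have := Pl g (to_limit x) (fun r => @limit_spt g r) (fun r => @limit_spt _ r).
  have := PhiL g (to_limit x).
  move=> + + E; rewrite E.
  have := metric_triangle (Phi' g) (Phi (to_limit x)) (Phi g).
  by rewrite (metric_sym (Phi (to_limit x)) (Phi g)); lra.
Qed.

End direct_system.

(** * Convergence to a direct limit *)

Lemma continuous_borel_measurable (R : realType) (X : ppmms R) (h : X -> R) :
  continuous h -> measurable_fun [set: borel X] (h : borel X -> R).
Proof.
move=> /continuousP ch.
apply: (@measurability _ _ (borel X) R setT h _ (RGenOpens.measurableE R)).
move=> _ [_ [a [b ->] <-]]; rewrite setTI.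
by apply: open_measurable_borel; apply: ch; exact: interval_open.
Qed.

Lemma measurable_enlarge (R : realType) (X : ppmms R) (A : set X) (e : R) :
  measurable (enlarge A e : set (borel X)).
Proof.
apply: open_measurable_borel.
have /continuousP cA := @edist_inf_continuous _ _ A.
exact: (cA _ (@open_ereal_lt_ereal _ e%:E)).
Qed.

(* A subset [A] carrying almost all of a finite bound [V] on the mass of [B]
   leaves little of [B] uncovered. *)
Lemma meas_setD_le (R : realType) (X : ppmms R) (A B : set (borel X))
    (V : \bar R) (e : R) :
  measurable A -> measurable B -> (V < +oo)%E -> (pp_meas X B <= V)%E ->
  (V < pp_meas X (A `&` B) + e%:E)%E -> (pp_meas X (B `\` A) <= e%:E)%E.
Proof.
move=> mA mB; rewrite (measureDI (pp_meas X) mB mA) (setIC B).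
have H (a b : \bar R) : (0 <= a)%E -> (0 <= b)%E -> (V < +oo)%E ->
    (b + a <= V)%E -> (V < a + e%:E)%E -> (b <= e%:E)%E.
  move: a b V => [a| |] [b| |] [v| |] //.
  by rewrite -!EFinD !lee_fin !lte_fin => *; lra.
by apply: H.
Qed.

Section target.
Context {R : realType} (X : nat -> ppmms R).
Variable phi : forall i j : nat, (i <= j)%N -> X i -> X j.
Hypothesis Hphi : is_direct_system phi.

Lemma target_unif_boundedly_finite (L : ppmms R) (f : forall i, X i -> L) :
  is_target phi f -> unif_boundedly_finite X.
Proof.
move=> [fM _] r r0; apply: le_lt_trans (pp_ball_fin (base L) r).
apply: ge_ereal_sup => _ [i _ <-]; have [mf fb fl fp] := fM i.
apply: le_trans (fp _ (measurable_ball_borel (base L) r)).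
apply: le_meas_spt; first exact: measurable_ball_borel.
  exact: borel_map_preimage mf (measurable_ball_borel _ _).
move=> x [Sx]; rewrite /= !ballEmdist /= => px; rewrite -fb.
by apply: le_lt_trans (fl _ _ (spt_base _) Sx) px.
Qed.

Definition mdist_is_lim_dist (L : ppmms R) (f : forall i, X i -> L) : Prop :=
  forall i j (x : X i) (y : X j), spt (X i) x -> spt (X j) y ->
    mdist (f i x) (f j y) = lim_dist phi x y.

Definition meas_is_lim (L : ppmms R) (f : forall i, X i -> L) : Prop :=
  forall B : set (borel L), measurable B ->
    (pp_meas (X i) (f i @^-1` B) @[i --> \oo] --> pp_meas L B)%E.

(** * Distances and measure of an arbitrary direct limit, transported from the constructed one *)

Section direct_limit.
Variables (L : ppmms R) (f : forall i, X i -> L).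
Arguments f : clear implicits.
Hypothesis fL : is_direct_limit phi f.

Let ubf : unif_boundedly_finite X := target_unif_boundedly_finite fL.1.
Let L0 := limit_ppmms Hphi ubf.
Let f0 : forall i, X i -> L0 := @to_limit R X phi Hphi.

(* Both [L] and [L0] are direct limits, so each maps to the other, and on the
   supports the two maps are mutually inverse. *)
Lemma direct_limit_iso : exists (Phi : L0 -> L) (Psi : L -> L0),
  [/\ is_morphism Phi, is_morphism Psi,
      (forall i x, spt (X i) x -> Phi (f0 x) = f i x),
      (forall i x, spt (X i) x -> Psi (f i x) = f0 x) &
      forall y, spt L y -> Phi (Psi y) = y].
Proof.
have [ft fu] := fL; have [f0t f0u] := to_limit_direct_limit Hphi ubf.
have [Phi [PhiM PhiE _]] := f0u _ _ ft.
have [Psi [PsiM PsiE _]] := fu _ _ f0t.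
have PhiE' i x : spt (X i) x -> Phi (f0 x) = f i x.
  by move=> Sx; rewrite PhiE ?inE.
have PsiE' i x : spt (X i) x -> Psi (f i x) = f0 x.
  by move=> Sx; rewrite /f0 PsiE ?inE.
exists Phi, Psi; split => // y Sy.
(* [Phi \o Psi] and [id] both factor [f] through itself, so uniqueness identifies both with [Id]. *)
have [Id [_ _ IdU]] := fu _ _ ft.
have H1 : mor_eq (Phi \o Psi) Id.
  apply: IdU; first exact: morphism_comp.
  by move=> i x; rewrite inE /= => Sx; rewrite PsiE'// PhiE'.
have H2 : mor_eq id Id by apply: IdU => //; exact: morphism_id.
by have := H1 y; rewrite -(H2 y) ?inE//; apply.
Qed.

(** Each of the two comparison maps is 1-Lipschitz and carries one family of images to the other. *)
Lemma direct_limit_mdist : mdist_is_lim_dist f.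
Proof.
have [Phi [Psi [PhiM PsiM PhiE PsiE _]]] := direct_limit_iso.
move=> i j x y Sx Sy; rewrite -(mdist_to_limit Hphi Sx Sy).
have ft := fL.1.1; have f0t := to_limit_morphism Hphi ubf.
have [_ _ Pl _] := PhiM; have [_ _ Ql _] := PsiM.
apply/eqP; rewrite eq_le; apply/andP; split.
  by rewrite -PhiE// -PhiE//; apply: Pl; exact: morphism_spt.
rewrite -[to_limit _ x]PsiE// -[to_limit _ y]PsiE//.
by apply: Ql; exact: morphism_spt.
Qed.

Lemma direct_limit_meas : meas_is_lim f.
Proof.
have [Phi [Psi [PhiM PsiM PhiE PsiE PhiPsi]]] := direct_limit_iso.
have [mPhi _ _ Pp] := PhiM; have [mPsi _ _ Qp] := PsiM.
move=> B mB; have mPB := borel_map_preimage mPhi mB.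
have -> : pp_meas L B = pp_meas L0 (Phi @^-1` B).
  apply/eqP; rewrite eq_le; apply/andP; split; last exact: Pp.
  apply: le_trans (Qp _ mPB); apply: le_meas_spt => //.
    exact: borel_map_preimage.
  by move=> y [Sy By]; rewrite /= PhiPsi.
have -> : (fun i => pp_meas (X i) (f i @^-1` B)) =
    (fun i => limit_image_measure Hphi i (Phi @^-1` B)).
  apply/funext => i; apply: eq_meas_spt.
  - by apply: borel_map_preimage => //; have [] := fL.1.1 i.
  - have [m _ _ _] := to_limit_morphism Hphi ubf i.
    exact: borel_map_preimage m mPB.
  by move=> x Sx; rewrite /= PhiE.
exact: sup_measure_cvg.
Qed.

End direct_limit.

(** * The canonical maps as weak approximations, and convergence *)

Section weak_approximation.
Variables (L : ppmms R) (f : forall i, X i -> L).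
Arguments f : clear implicits.
Hypotheses (ft : is_target phi f) (fd : mdist_is_lim_dist f) (fm : meas_is_lim f).

Lemma target_trans i j (x : X i) : (i <= j)%N -> spt (X i) x ->
  f j (trans phi j x) = f i x.
Proof. by move=> ij Sx; rewrite (transE _ ij) (ft.2 _ _ ij)// inE. Qed.

(* At a late stage, the points whose image in the limit is near that of one of
   finitely many centers of an earlier stage carry almost all the mass, and the
   distances between the centers have nearly reached their limits. *)
Lemma target_weak_approx r e : 0 < e < r ->
  \forall j \near \oo, weak_approx r e (f j).
Proof.
move=> /andP[e0 er]; pose B : set (borel L) := ball (base L) r.
have mB : measurable B by exact: measurable_ball_borel.
have Boo : (pp_meas L B < +oo)%E by exact: pp_ball_fin.
have fB j : measurable (f j @^-1` B : set (borel (X j))).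
  by have [mf _ _ _] := ft.1 j; exact: borel_map_preimage.
(* The distortion estimate adds five errors of at most [d]: two at stage [j], two in the limit, one
   between the centers. *)
pose d := e / 8; have d0 : 0 < d by rewrite divr_gt0.
(* Finiteness of the mass of [B] rules out that every stage misses at least [e] of it. *)
have [i Bi] : exists i, (pp_meas L B < pp_meas (X i) (f i @^-1` B) + e%:E)%E.
  apply/not_existsP => H.
  have : (pp_meas L B <= pp_meas L B - e%:E)%E.
    apply: cvge_le (fm mB); apply: nearW => i.
    by rewrite leeBrDr// leNgt; apply/negP; exact: H.
  rewrite leNgt lteBlDr// => /negP; apply.
  by rewrite -[ltLHS]adde0 lteD2lE ?lte_fin// ge0_fin_numE.
have lim_ball_spt : forall x, spt (X i) x -> (f i @^-1` B) x <-> lim_ball phi r x.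
  move=> x Sx; rewrite /B /= ballEmdist /=.
  have [_ <- _ _] := ft.1 i; rewrite fd//; last exact: spt_base.
  by split=> [|[]].
have [s [sS sd]] := spt_dense_seq (X i).
(* The base point is center 0, so that the set [A] below contains the base point of [X j]. *)
pose c n := if n is k.+1 then s k else base (X i).
have cS n : spt (X i) (c n) by case: n => [|n] /=; [exact: spt_base|exact: sS].
pose near_c j n : set (X j) :=
  \bigcup_(k in [set k | (k <= n)%N]) ball (trans phi j (c k)) d.
have o_near j n : open (near_c j n).
  by apply: bigcup_open => k _; exact: metric_ball_open.
have m_near j n : measurable (near_c j n : set (borel (X j))).
  exact: open_measurable_borel.
(* Here [n] bounds both the centers used and the delay after which the point has entered the
   [r]-ball; the sets increase to [lim_ball phi r]. *)
pose G n : set (borel (X i)) := spt (X i) `&` (near_c i n `&`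
  @trans _ _ phi i (i + n) @^-1` ball (base (X (i + n))) r).
have mG n : measurable (G n).
  apply: measurableI; first exact: measurable_spt.
  apply: measurableI => //.
  by apply: (measurable_trans Hphi); [exact: leq_addr|exact: measurable_ball_borel].
have Tmono m n x : (m <= n)%N -> spt (X i) x ->
    ball (base (X (i + m))) r (trans phi (i + m) x) ->
    ball (base (X (i + n))) r (trans phi (i + n) x).
  by move=> mn Sx; apply: (trans_ball Hphi) => //; [exact: leq_addr|rewrite leq_add2l].
have ndG : nondecreasing_seq G.
  move=> m n mn; apply/subsetPset => x [Sx [[k /= km kx] Tx]].
  split => //; split; last exact: Tmono Tx.
  by exists k => //=; exact: leq_trans mn.
have UG : \bigcup_n G n = lim_ball phi r.
  rewrite (lim_ballE Hphi).
  apply/seteqP; split => [x [n _ [Sx [_ Tx]]]|x [n _ [Sx Tx]]]; first by exists n.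
  have [m xm] := sd _ _ Sx d0; exists (maxn n m.+1) => //; split => //; split.
    exists m.+1; first by rewrite /= leq_maxr.
    by rewrite ballEmdist /= (trans_id Hphi)// metric_sym.
  exact: Tmono (leq_maxl _ _) Sx Tx.
have [n Gn] : exists n, (pp_meas L B < pp_meas (X i) (G n) + e%:E)%E.
  apply/not_existsP => H.
  have : (pp_meas (X i) (f i @^-1` B) <= pp_meas L B - e%:E)%E.
    rewrite (eq_meas_spt (fB i) (measurable_lim_ball Hphi r) lim_ball_spt) -UG.
    have cvG : (pp_meas (X i) \o G @ \oo --> pp_meas (X i) (\bigcup_n G n))%E.
      by apply: nondecreasing_cvg_mu => //; exact: bigcupT_measurable.
    apply: cvge_le cvG; apply: nearW => n.
    by rewrite leeBrDr//= leNgt; apply/negP; exact: H.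
  by rewrite leeBrDr// leNgt Bi.
(* Only finitely many pairs of centers occur, so one stage serves them all. *)
have [N NP] : exists N, forall j a b, (N <= j)%N -> (a <= n)%N -> (b <= n)%N ->
    mdist (trans phi j (c a)) (trans phi j (c b)) < lim_dist phi (c a) (c b) + d.
  have /choice[K KP] : forall ab : nat * nat, exists N, forall j, (N <= j)%N ->
      mdist (trans phi j (c ab.1)) (trans phi j (c ab.2)) <
      lim_dist phi (c ab.1) (c ab.2) + d.
    move=> [a b] /=.
    have ltd : lim_dist phi (c a) (c b) < lim_dist phi (c a) (c b) + d by lra.
    by have [N [_ _ NP]] := lim_dist_lt Hphi (cS a) (cS b) ltd; exists N.
  exists (\max_(a < n.+1) \max_(b < n.+1) K (val a, val b)).
  move=> j a b Nj an bn; apply: (KP (a, b)); apply: leq_trans Nj.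
  apply: leq_trans (leq_bigmax (Ordinal (an : (a < n.+1)%N))).
  exact: (leq_bigmax (Ordinal (bn : (b < n.+1)%N))).
exists (maxn N (i + n)) => // j /=; rewrite geq_max => /andP[Nj inj].
have ij : (i <= j)%N := leq_trans (leq_addr n i) inj.
have [mfj fjb fjl fjp] := ft.1 j.
pose A : set (borel (X j)) :=
  spt (X j) `&` (near_c j n `&` ball (base (X j)) r).
have mBj : measurable (ball (base (X j)) r : set (borel (X j))).
  exact: measurable_ball_borel.
have mA : measurable A.
  by apply: measurableI; [exact: measurable_spt|exact: measurableI].
have AB : A `<=` f j @^-1` B.
  move=> x [Sx [_]]; rewrite /B /= !ballEmdist /= => xr; rewrite -fjb.
  by apply: le_lt_trans xr; apply: fjl => //; exact: spt_base.
(* The transition map to stage [j] sends [G n] into [A], so [A] has at least the mass of [G n]. *)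
have le_meas_A : (pp_meas L B < pp_meas (X j) A + e%:E)%E.
  apply: lt_le_trans Gn _; rewrite leeD2r//.
  have [_ _ _ tp] := trans_morphism Hphi ij.
  apply: le_trans (tp _ mA); apply: le_meas_spt => //.
    exact: (measurable_trans Hphi).
  move=> x [Sx [_ [[k /= kn]]]]; rewrite /= ballEmdist /= (trans_id Hphi)// => kx Tx.
  split; first exact: trans_spt.
  split; last exact: (trans_ball Hphi (leq_addr n i) inj Sx Tx).
  exists k => //; rewrite ballEmdist /=.
  exact: le_lt_trans (trans_lipschitz Hphi ij (cS k) Sx) kx.
split => //; first by rewrite e0.
exists A; split.
- by split => // x [_ []].
- split; first exact: spt_base.
  split; last by apply: ballxx; exact: lt_trans er.
  by exists 0%N => //=; rewrite (trans_base Hphi ij); exact: ballxx.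
- move=> x y [Sx [[a /= an]]]; rewrite ballEmdist /= => ax _.
  move=> [Sy [[b /= bn]]]; rewrite ballEmdist /= => bx _.
  have := NP _ _ _ Nj an bn; rewrite -fd// -(target_trans ij (cS a)).
  rewrite -(target_trans ij (cS b)).
  have Sa := trans_spt Hphi ij (cS a); have Sb := trans_spt Hphi ij (cS b).
  have := fjl _ _ Sx Sy; have := fjl _ _ Sa Sx; have := fjl _ _ Sb Sy.
  have := mdist_dist x y (trans phi j (c a)) (trans phi j (c b)).
  have := mdist_dist (f j (trans phi j (c a))) (f j (trans phi j (c b))) (f j x) (f j y).
  rewrite (metric_sym x (trans phi j (c a))) (metric_sym y (trans phi j (c b))).
  rewrite !ler_norml /d in ax bx * => *.
  by apply/andP; split; lra.
- apply: (meas_setD_le (V := pp_meas L B)) => //.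
    apply: le_trans (fjp _ mB); apply: le_meas_spt => // x [Sx].
    rewrite /B /= !ballEmdist /= -fjb; apply: le_lt_trans.
    by apply: fjl => //; exact: spt_base.
  rewrite (_ : A `&` _ = A)//; apply: setIidl.
  by move=> x [_ []].
- set E := enlarge _ _.
  have mE : measurable (E : set (borel L)) by exact: measurable_enlarge.
  (* The mass count concerns the larger ball [B]. There [A] lies in the preimage of [E] and [B]
     together, so their intersection has nearly full mass. *)
  apply: le_trans (_ : (pp_meas L (B `\` E) <= _)%E).
    apply: le_measure; rewrite ?inE; [|exact: measurableD|].
      by apply: measurableD => //; exact: measurable_ball_borel.
    by apply: setSD; apply: le_ball; lra.
  apply: (meas_setD_le (V := pp_meas L B)) => //.
  apply: lt_le_trans le_meas_A _; rewrite leeD2r//.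
  have mEB : measurable (E `&` B : set (borel L)) by exact: measurableI.
  apply: le_trans (fjp _ mEB); apply: le_measure; rewrite ?inE//.
    exact: borel_map_preimage.
  move=> x Ax; split; last exact: AB.
  by rewrite /E /enlarge /= edist_inf0 ?lte_fin//; exists x.
Qed.

(** After passing to image measures on [L], setwise convergence on a ball containing the support of
    [h] suffices. *)
Lemma target_weak_cvg (h : L -> R) (M : R) :
  continuous h -> (forall y, `|h y| <= M) -> bounded_support h ->
  (\int[pp_meas (X i)]_x (h (f i x))%:E @[i --> \oo]
     --> \int[pp_meas L]_y (h y)%:E)%E.
Proof.
move=> ch hM [r hr]; have mh := continuous_borel_measurable ch.
have mB := measurable_ball_borel (base L) r.
have hB y : ~ ball (base L) r y -> h y = 0.
  by move=> nBy; apply/eqP/negPn/negP => /hr.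
have mf i : measurable_fun [set: borel (X i)] (f i : borel (X i) -> borel L).
  by have [] := ft.1 i.
have fle i B : measurable B -> (image_measure (pp_meas (X i)) (mf i) B <= pp_meas L B)%E.
  by have [_ _ _] := ft.1 i; apply.
have Boo := pp_ball_fin (base L) r.
have -> : (fun i => (\int[pp_meas (X i)]_x (h (f i x))%:E)%E) =
    (fun i => (\int[image_measure (pp_meas (X i)) (mf i)]_y (h y)%:E)%E).
  apply/funext => i; rewrite (bounded_integral_image_measure (mf i) mh hM mB hB)//.
  exact: le_lt_trans (fle i _ mB) Boo.
by apply: (@setwise_cvg_integral _ (borel L) R
    (fun i => image_measure (pp_meas (X i)) (mf i)) (pp_meas L) h
    (ball (base L) r) M) => //; exact: fm.
Qed.

(* Diagonal argument: [k i] is the largest scale [n <= i] at which the maps are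
   weak approximations from stage [i] on. *)
Lemma target_wpmGH_cvg : wpmGH_cvg X L.
Proof.
have /choice[N NP] : forall n, exists N, forall j, (N <= j)%N ->
    (* These shifts ensure [0 < e < r] already at [n = 0]. *)
    weak_approx n.+2%:R n.+1%:R^-1 (f j).
  move=> n; have [|N _ NP] := @target_weak_approx n.+2%:R n.+1%:R^-1.
    rewrite invr_gt0 ltr0Sn /= (@le_lt_trans _ _ 1)//.
      by rewrite invf_le1 ?ler1n// ltr0Sn.
    by rewrite ltr1n.
  by exists N.
pose k i := \max_(n < i.+1 | (N n <= i)%N) val n.
(* Before stage [N 0] the maximum may range over nothing and take the default 0; from there on the
   index 0 is admissible. *)
have kP i : (N 0%N <= i)%N -> (N (k i) <= i)%N.
  move=> N0; rewrite /k.
  have [n Nn ->] := @eq_bigmax_cond _ [pred n : 'I_i.+1 | (N n <= i)%N] val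
    (introT card_gt0P (ex_intro _ ord0 N0)).
  exact: Nn.
have k_ge i n : (N n <= i)%N -> (n <= i)%N -> (n <= k i)%N.
  move=> Nn ni; exact: (@leq_bigmax_cond _ _ _ (Ordinal (ni : (n < i.+1)%N))).
have nd_k i j : (i <= j)%N -> (k i <= k j)%N.
  move=> ij; apply/bigmax_leqP => n Nn; apply: k_ge; first exact: leq_trans ij.
  by rewrite -ltnS; exact: leq_trans (ltn_ord n) _.
have k_oo n : \forall i \near \oo, (n <= k i)%N.
  exists (maxn (N n) n) => // i /=; rewrite geq_max => /andP[Nn ni].
  exact: k_ge.
exists (fun i => (k i).+2%:R), (fun i => (k i).+1%:R^-1), f; split.
- split; first by move=> i j ij; rewrite ler_nat !ltnS; exact: nd_k.
  apply/cvgryPge => A; have := k_oo (Num.truncn `|A|).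
  apply: filterS => i Ai; apply: le_trans (ler_norm A) _.
  apply: le_trans (ltW (truncnS_gt _)) _.
  by rewrite ler_nat ltnS; exact: leqW.
- split.
    move=> i j ij; rewrite lef_pV2 ?posrE ?ltr0Sn//.
    by rewrite ler_nat ltnS; exact: nd_k.
  apply/cvgrPdist_le => e e0; have [n ne] := exists_invS_lt e0.
  have := k_oo n; apply: filterS => i ni.
  rewrite sub0r normrN ger0_norm ?invr_ge0//; apply: le_trans (ltW ne).
  by rewrite lef_pV2 ?posrE ?ltr0Sn// ler_nat ltnS.
- by move=> i; have [] := ft.1 i.
- by exists (N 0%N) => // i /= Ni; apply: NP; exact: kP.
- by move=> h ch [M hM] hs; exact: target_weak_cvg hM hs.
Qed.

End weak_approximation.

End target.

Theorem corollary14p2 (R : realType) (X : nat -> ppmms R)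
    (phi : forall i j : nat, (i <= j)%N -> X i -> X j)
    (Hphi : is_direct_system phi) :
  ((exists (L : ppmms R) (f : forall i, X i -> L), is_direct_limit phi f)
     <-> unif_boundedly_finite X) /\
  (forall (L : ppmms R) (f : forall i, X i -> L),
     is_direct_limit phi f -> wpmGH_cvg X L).
Proof.
split; first split.
- by move=> [L [f [ft _]]]; exact: target_unif_boundedly_finite ft.
- by move=> ubf; exists (limit_ppmms Hphi ubf); eexists; exact: to_limit_direct_limit.
- move=> L f fL; apply: (target_wpmGH_cvg Hphi fL.1).
    exact: (direct_limit_mdist Hphi fL).
  exact: (direct_limit_meas Hphi fL).
Qed.
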